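(* Let $K$ be a finite field of order $q$ and $\mathbf{F}$ the free group on $r\ge1$ generators. Suppose that $w\in\mathbf{F}$, $m\in\mathbb{Z}_{\ge1}$ and $\mathcal{B}\in\mathrm{GL}_m(K)$. Then for every large enough $N$, the expectation $\mathbb{E}_w[\tilde{\mathcal{B}}]$ is given by a rational function in $q^N$; that is, there are a one-variable rational function $R$ with real coefficients (depending on $K,w,\mathcal{B}$ but not on $N$) and an integer $N_0$ such that $\mathbb{E}_w[\tilde{\mathcal{B}}]=R(q^N)$ for all $N\ge N_0$.
   Context: For $\mathcal{B}\in\mathrm{GL}_m(K)$ and any $N\ge1$, the function $\tilde{\mathcal{B}}:\mathrm{GL}_N(K)\to\mathbb{Z}_{\ge0}$ is $$\tilde{\mathcal{B}}(g)=\#\{M\in M_{m\times N}(K)\mid Mg=\mathcal{B}M\}.$$ $\mathbf{F}$ has a fixed basis $b_1,\ldots,b_r$, and $w(g_1,\ldots,g_r)$ is the image of $w$ under the homomorphism $b_i\mapsto g_i$. $\mathbb{E}_w[\tilde{\mathcal{B}}]$ is the expected value of $\tilde{\mathcal{B}}(w(g_1,\ldots,g_r))$ where $g_1,\ldots,g_r$ are independent uniformly random elements of $\mathrm{GL}_N(K)$ (a number for each $N$). *)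

(* Defs.v *)
From HB Require Import structures.
From mathcomp Require Import all_boot all_order all_algebra all_fingroup.
From mathcomp Require Import reals.

Set Implicit Arguments.
Unset Strict Implicit.
Unset Printing Implicit Defensive.

Import Order.TTheory GRing.Theory Num.Theory.
Local Open Scope group_scope.

(* The free group on b_0, ..., b_(r-1), realized as the set of reduced words.
   The letter (i, false) stands for b_i and (i, true) for its inverse. *)
Section FreeGroup.
Variable r : nat.

Definition letter := ('I_r * bool)%type.
Definition linv (a : letter) : letter := (a.1, ~~ a.2).

Lemma linvK : involutive linv.
Proof. by case=> i e; rewrite /linv /= negbK. Qed.

Definition reduced (s : seq letter) : bool :=
  sorted (fun a b => b != linv a) s.

Record freeGroup := FreeGroup { fg_word :> seq letter; _ : reduced fg_word }.

HB.instance Definition _ := [isSub for fg_word].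
HB.instance Definition _ := [Choice of freeGroup by <:].

(* Left multiplication of a reduced word by a letter. *)
Definition lact (a : letter) (s : seq letter) : seq letter :=
  if s is b :: t then if b == linv a then t else a :: s else [:: a].

Lemma reduced_lact a s : reduced s -> reduced (lact a s).
Proof.
case: s => [|b s] //= bs; case: eqVneq => [_|ne]; last by rewrite /= ne.
exact: path_sorted bs.
Qed.

Lemma lactK a s : reduced s -> lact a (lact (linv a) s) = s.
Proof.
case: s => [|b s] /=; first by rewrite eqxx.
rewrite linvK; case: eqVneq => [->|_]; last by rewrite /= eqxx.
by case: s => [|c s] //= /andP[/negbTE->].
Qed.

Lemma reduced_foldr s t : reduced t -> reduced (foldr lact t s).
Proof. by move=> rt; elim: s => //= a s; exact: reduced_lact. Qed.

Lemma foldr_lact_nil s : reduced s -> foldr lact [::] s = s.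
Proof.
elim: s => //= a s IHs rs; rewrite (IHs (path_sorted rs)).
case: s rs {IHs} => //= b s /andP[/negbTE-> _] //.
Qed.

Lemma foldr_lact a s u : reduced u ->
  foldr lact u (lact a s) = lact a (foldr lact u s).
Proof.
move=> ru; case: s => [|b s] //=; case: eqVneq => [->|//].
by rewrite lactK // reduced_foldr.
Qed.

Definition fg_mul (s t : freeGroup) : freeGroup :=
  FreeGroup (reduced_foldr s (valP t)).

Definition fg_one : freeGroup := @FreeGroup [::] isT.

Lemma reduced_inv s : reduced s -> reduced (rev (map linv s)).
Proof.
rewrite /reduced rev_sorted sorted_map; apply: sub_sorted => a b /=.
by rewrite linvK eq_sym (can2_eq linvK linvK).
Qed.

Definition fg_inv (s : freeGroup) : freeGroup :=
  FreeGroup (reduced_inv (valP s)).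

Lemma fg_mulA : associative fg_mul.
Proof.
move=> s t u; apply: val_inj => /=.
by elim: (fg_word s) => //= a s' ->; rewrite foldr_lact // (valP u).
Qed.

Lemma fg_mul1 : left_id fg_one fg_mul.
Proof. by move=> s; apply: val_inj. Qed.

Lemma fg_mulr1 : right_id fg_one fg_mul.
Proof. by move=> s; apply: val_inj; rewrite /= foldr_lact_nil ?(valP s). Qed.

Lemma fg_mulV : left_inverse fg_one fg_inv fg_mul.
Proof.
move=> s; apply: val_inj => /=; case: s => s /= rs.
elim: s rs => //= a s IHs rs; rewrite rev_cons -cats1 foldr_cat /= linvK eqxx.
exact: IHs (path_sorted rs).
Qed.

Lemma fg_invK : involutive fg_inv.
Proof.
move=> s; apply: val_inj => /=; rewrite map_rev revK -map_comp.
by rewrite (eq_map (g := id)) ?map_id // => a; exact: linvK.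
Qed.

Lemma fg_mulrV : right_inverse fg_one fg_inv fg_mul.
Proof. by move=> s; rewrite -{1}[s]fg_invK fg_mulV. Qed.

HB.instance Definition _ :=
  isGroup.Build freeGroup fg_mulA fg_mul1 fg_mulr1 fg_mulV fg_mulrV.

Definition fg_gen (i : 'I_r) : freeGroup := @FreeGroup [:: (i, false)] isT.

Section Lift.
Variables (G : groupType) (g : 'I_r -> G).

Definition eval_letter (a : letter) : G := if a.2 then (g a.1)^-1 else g a.1.

(* w(g_1, ..., g_r), the image of w under the homomorphism b_i |-> g_i; the
   universal property is eval_wordM, eval_word_gen and eval_word_unique. *)
Definition eval_word (w : freeGroup) : G := \prod_(a <- fg_word w) eval_letter a.

Lemma eval_linv a : eval_letter (linv a) = (eval_letter a)^-1.
Proof. by case: a => i [] //=; rewrite /eval_letter /= invgK. Qed.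

Lemma eval_wordM : {morph eval_word : v w / v * w}.
Proof.
move=> [v rv] [w rw]; rewrite /eval_word /=; elim: v {rv} => [|a v IHv] /=.
  by rewrite big_nil mul1g.
rewrite big_cons -mulgA -IHv; case: (foldr _ _ _) => [|b t] /=.
  by rewrite big_seq1 big_nil mulg1.
by case: eqVneq => [->|_]; rewrite !big_cons // eval_linv mulVKg.
Qed.

Lemma eval_word_gen i : eval_word (fg_gen i) = g i.
Proof. by rewrite /eval_word big_seq1. Qed.

Lemma eval_word_unique (f : freeGroup -> G) :
  {morph f : v w / v * w} -> (forall i, f (fg_gen i) = g i) -> f =1 eval_word.
Proof.
move=> fM fg; have f1: f 1 = 1.
  by apply: (mulgI (f 1)); rewrite -fM !mulg1.
have fl a (ra : reduced [:: a]) : f (FreeGroup ra) = eval_letter a.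
  case: a ra => i [] ra; rewrite /eval_letter /= -fg; last first.
    by congr f; exact: val_inj.
  apply: (mulgI (f (fg_gen i))); rewrite mulgV -fM -f1; congr f.
  by apply: val_inj; rewrite /= eqxx.
case=> w; elim: w => [|a w IHw] rw.
  by rewrite /eval_word big_nil -f1; congr f; exact: val_inj.
have rw' : reduced w := path_sorted rw.
rewrite /eval_word big_cons -(fl a isT).
have := IHw rw'; rewrite /eval_word /= => <-; rewrite -fM; congr f.
apply: val_inj => /=; case: w rw {IHw rw'} => //= b w /andP[/negbTE->] //.
Qed.

End Lift.
End FreeGroup.

Local Open Scope ring_scope.

(* The matrices underlying {'GL_n[K]} have size n.-1.+1, which is n for n > 0
   (the only case considered). *)
Definition fixcount (K : finFieldType) (m N : nat) (B : {'GL_m[K]})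
    (g : {'GL_N[K]}) : nat :=
  #|[set M : 'M[K]_(m.-1.+1, N.-1.+1) | M *m GLval g == GLval B *m M]|.

(* Expected value of phi (w (g_1, ..., g_r)) for independent uniformly random
   g_i in a finite group G, i.e. for a uniformly random r-tuple. *)
Definition word_expectation (R : realType) (r : nat) (w : freeGroup r)
    (G : finGroupType) (phi : G -> R) : R :=
  (\sum_(g : {ffun 'I_r -> G}) phi (eval_word g w)) / #|{ffun 'I_r -> G}|%:R.

(* Main.v *)
Require Import Defs.
From mathcomp Require Import all_boot all_order all_algebra all_fingroup.
From mathcomp Require Import reals.
Import GRing.Theory Num.Theory.
Local Open Scope ring_scope.

(** Write [w] as a product of letters [a_1 ... a_l].  A solution [M] of
    [M w(g) = B M] is the same thing as a trajectory [M_0 = M],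
    [M_i = M_(i-1) a_i(g)] that ends at [M_l = B M_0].  Stacking the [M_i] into
    one matrix [Z] with a number [D] of rows that does not depend on [N], the
    conditions become, for each generator [j], one equation
    [A_j Z g_j = C_j Z] with constant matrices [A_j] and [C_j], together with
    one equation [H Z = 0] (lemma [word_system]).

    Everything then depends on [Z] only through the linear relations between
    its rows, that is, through its left kernel, a subspace of [K^D].  Indeed
    [GL_N] acts transitively on the matrices with a given left kernel, so for
    a uniformly random [h] the probability of [X h = Y] is zero unless [X] and
    [Y] have the same left kernel, and otherwise it is the inverse of the
    number of matrices sharing this kernel (lemma [prob_transport]).  If [X]
    has rank [k], this number is
    [(q^N - 1)(q^N - q) ... (q^N - q^(k-1))], a polynomial in [q^N]
    (lemma [card_lker]).

    As the [g_j] are independent, the expectation is a sum over [Z] of products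
    of such inverses.  Grouping the [Z] by left kernel turns it into a sum over
    the finitely many subspaces of [K^D], a range that does not involve [N], of
    quotients of polynomials in [q^N] (lemma [mean_solutions]).  The
    denominators have no zero at [q^N] once [N >= D]. *)

(** * Left kernels *)

Section LeftKernel.
Set Implicit Arguments.
Unset Strict Implicit.
Variable K : fieldType.

(** The generator [<<_>>] is canonical, so that two matrices, possibly of
    different widths, have the same relations between their rows exactly when
    their [lker] are equal for Leibniz equality. *)
Definition lker d n (X : 'M[K]_(d, n)) : 'M_d := <<kermx X>>%MS.

Lemma sub_lker p d n (A : 'M_(p, d)) (X : 'M[K]_(d, n)) :
  (A <= lker X)%MS = (A *m X == 0).
Proof. by rewrite genmxE sub_kermx. Qed.

Lemma eq_lker d n p (X : 'M[K]_(d, n)) (Y : 'M_(d, p)) :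
  (forall A : 'M_d, (A *m X == 0) = (A *m Y == 0)) -> lker X = lker Y.
Proof.
by move=> eqXY; apply/genmxP; rewrite !sub_kermx eqXY -eqXY !mulmx_ker !eqxx.
Qed.

Lemma lker_eq0 d n p (X : 'M[K]_(d, n)) (Y : 'M_(d, p)) s (A : 'M_(s, d)) :
  lker X = lker Y -> (A *m X == 0) = (A *m Y == 0).
Proof. by move=> eqXY; rewrite -!sub_lker eqXY. Qed.

Lemma lker_mull d n p (X : 'M[K]_(d, n)) (Y : 'M_(d, p)) s (A : 'M_(s, d)) :
  lker X = lker Y -> lker (A *m X) = lker (A *m Y).
Proof. by move=> eqXY; apply: eq_lker => C; rewrite !mulmxA (lker_eq0 _ eqXY). Qed.

Lemma lker_mulr d n p (X : 'M[K]_(d, n)) (T : 'M_(n, p)) :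
  row_free T -> lker (X *m T) = lker X.
Proof. by move=> fT; apply: eq_lker => A; rewrite mulmxA mulmx_free_eq0. Qed.

Lemma lker_rank d n p (X : 'M[K]_(d, n)) (Y : 'M_(d, p)) :
  lker X = lker Y -> \rank X = \rank Y.
Proof.
move=> /(congr1 mxrank); rewrite !mxrank_gen !mxrank_ker => eqr.
by rewrite -(subKn (rank_leq_row X)) eqr subKn ?rank_leq_row.
Qed.

(** Each row of [1 - X *m pinvmx X] is a relation between the rows of [X],
    hence also one between the rows of [Y]. *)
Lemma lker_factor d n p (X : 'M[K]_(d, n)) (Y : 'M_(d, p)) :
  lker X = lker Y -> X *m (pinvmx X *m Y) = Y.
Proof.
move=> /lker_eq0 eqXY; apply/eqP; rewrite mulmxA eq_sym -subr_eq0 -{1}[Y]mul1mx.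
by rewrite -mulmxBl -eqXY mulmxBl mul1mx mulmxKpV // subrr.
Qed.

(** Thus [cokermx (lker X)] is a canonical representative of the class of [X],
    whose format [d * d] is independent of the width of [X]. *)
Lemma lker_coker_lker d n (X : 'M[K]_(d, n)) : lker (cokermx (lker X)) = lker X.
Proof. by apply: eq_lker => A; rewrite -submxE sub_lker. Qed.

(** The orbits of the linear group acting on the right are the classes of
    matrices with a given left kernel: a factorization of [Y] through [X]
    preserves the rank, hence can be completed to an invertible one. *)
Lemma lker_unit_factor d n (X Y : 'M[K]_(d, n)) :
  reflect (exists2 g, g \in unitmx & X *m g = Y) (lker X == lker Y).
Proof.
apply: (iffP eqP) => [eqXY | [g ug <-]]; last first.
  by rewrite lker_mulr // row_free_unit.
have /complete_unitmx[g ug] : \rank (X *m (pinvmx X *m Y)) = \rank X.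
  by rewrite lker_factor // (lker_rank eqXY).
by rewrite lker_factor // => ->; exists g.
Qed.

End LeftKernel.

(** * Counting matrices with a given left kernel *)

Section CountLeftKernel.
Set Implicit Arguments.
Unset Strict Implicit.
Variables (R : comNzRingType) (K : finFieldType).
Local Notation q := #|K|.

(** Its value at [q ^ n] is the number of injective linear maps from [K^k] to
    [K^n]. *)
Definition inj_poly k : {poly R} := \prod_(i < k) ('X - (q ^ i)%:R%:P).

Lemma row_free_col_mx k n (v : 'rV[K]_n) (T : 'M_(k, n)) :
  row_free (col_mx v T) = row_free T && ~~ (v <= T)%MS.
Proof.
rewrite -!row_leq_rank -addsmxE; have [fT | nfT] := boolP (k <= \rank T)%N.
  have /eqP rT : \rank T == k by rewrite eqn_leq rank_leq_row.
  rewrite -[k in (1 + k <= _)%N]rT add1n (ltn_leqif (mxrank_leqif_sup (addsmxSr _ _))).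
  by rewrite addsmx_sub submx_refl andbT.
apply: contraNF nfT => le_rank; rewrite -(leq_add2l 1) (leq_trans le_rank) //.
by rewrite (leq_trans (mxrank_adds_leqif _ _)) // leq_add2r rank_leq_row.
Qed.

(** A row can be put on top of [k] independent rows in [q^n - q^k] ways, since
    it only has to avoid their span.  The equality holds for [k > n] too: both
    sides are then zero, the right one through its factor of index [n]. *)
Lemma card_row_free k n :
  #|[set T : 'M[K]_(k, n) | row_free T]|%:R = (inj_poly k).[(q ^ n)%:R].
Proof.
elim: k => [|k IHk].
  rewrite /inj_poly big_ord0 hornerC (@eq_card1 _ (0 : 'M_(0, n))) // => A.
  by rewrite !inE flatmx0 eqxx -row_leq_rank.
rewrite /inj_poly big_ord_recr hornerM [X in X * _]/= -/(inj_poly k) -IHk.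
rewrite !hornerE -sum1_card.
pose cm (p : 'M_(k, n) * 'rV_n) : 'M[K]_(1 + k, n) := col_mx p.2 p.1.
rewrite (reindex cm) /=; last first.
  exists (fun A => (dsubmx A, usubmx A)) => [[T v] _|A _]; last exact: vsubmxK.
  by rewrite /cm col_mxKu col_mxKd.
rewrite (eq_bigl (fun p => row_free p.1 && ~~ (p.2 <= p.1)%MS)); last first.
  by case=> T v; rewrite !inE row_free_col_mx.
rewrite -(pair_big_dep (fun T => row_free T)
  (fun T v => ~~ (v <= T)%MS) (fun _ _ => 1%N)) /=.
rewrite natr_sum -sum1dep_card natr_sum big_distrl /=; apply: eq_bigr => T fT.
rewrite mul1r sum1_card.
pose span := [set v *m T | v in 'rV_k].
rewrite (@eq_card _ _ (~: span)) => [|v]; last first.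
  rewrite !inE; congr (~~ _).
  by apply/submxP/imsetP => [] [u]; exists u.
have card_span : #|span| = (q ^ k)%N.
  by rewrite card_imset ?card_mx ?mul1n //; exact: row_free_inj fT.
rewrite cardsCs setCK card_span natrB card_mx ?mul1n //.
by have := max_card (mem span); rewrite card_span card_mx mul1n.
Qed.

(** A column base [P] of [X] has a left inverse and the same left kernel as
    [X], so the matrices in the class of [X] are the products [P *m T] for a
    unique [T] with independent rows. *)
Lemma card_lker d n p (X : 'M[K]_(d, p)) :
  #|[set Y : 'M[K]_(d, n) | lker X == lker Y]|%:R
    = (inj_poly (\rank X)).[(q ^ n)%:R].
Proof.
have eqPX : lker (col_base X) = lker X.
  by rewrite -[in RHS](mulmx_base X) lker_mulr ?row_base_free.
have pinvP : pinvmx (col_base X) *m col_base X = 1%:M.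
  by rewrite mulVpmx ?col_base_full.
have injP : injective (mulmx (col_base X) : 'M_(_, n) -> 'M_(d, n)).
  by apply: can_inj (mulmx (pinvmx (col_base X))) _ => T; rewrite mulmxA pinvP mul1mx.
rewrite -card_row_free -(card_imset _ injP); congr (_%:R); apply: eq_card => Y.
rewrite inE; apply/eqP/imsetP => [eqXY | [T]]; last first.
  by rewrite inE => fT ->; rewrite lker_mulr ?eqPX.
exists (pinvmx (col_base X) *m Y); last by rewrite lker_factor ?eqPX.
rewrite inE -row_leq_rank {1}(lker_rank eqXY).
by rewrite -[Y in (\rank Y <= _)%N](lker_factor (etrans eqPX eqXY)) mxrankM_maxr.
Qed.

End CountLeftKernel.

(** * Transporting a matrix by a random invertible matrix *)

Section ProbTransport.
Set Implicit Arguments.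
Unset Strict Implicit.
Variables (R : numFieldType) (K : finFieldType) (n d : nat).
Local Notation q := #|K|.
Local Notation GL := {'GL_n.+1[K]}.

(** Orbit counting: the group is partitioned by the values of [X *m g], and its
    parts are cosets of the stabilizer of [X]. *)
Lemma card_transport (X Y : 'M[K]_(d, n.+1)) :
  (#|[set g : GL | X *m GLval g == Y]| * #|[set Y' : 'M_(d, n.+1) | lker X == lker Y']|
    = (lker X == lker Y) * #|{: GL}|)%N.
Proof.
have ex_g Y' : lker X == lker Y' -> exists g : GL, X *m GLval g = Y'.
  by move/lker_unit_factor => [g ug <-]; exists (insubd (1%g : GL) g); rewrite insubdK.
have card_fiber Y' : lker X == lker Y' ->
    #|[set g : GL | X *m GLval g == Y']| = #|[set g : GL | X *m GLval g == X]|.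
  move=> /ex_g[h <-]; rewrite -[RHS](card_imset _ (mulIg h)); apply: eq_card => g.
  rewrite inE; apply/eqP/imsetP => [Xg | [f]].
    exists (g * h^-1)%g; last by rewrite mulgKV.
    by rewrite inE GL_ME mulmxA Xg -mulmxA -[GLval h *m _]GL_ME mulgV mulmx1.
  by rewrite inE => /eqP Xf ->; rewrite GL_ME mulmxA Xf.
have [eqXY | neXY] := boolP (lker X == lker Y); last first.
  rewrite mul0n (_ : [set g : GL | _] = set0) ?cards0 ?mul0n //.
  apply/setP=> g; rewrite !inE; apply: contraNF neXY => Xg.
  by apply/lker_unit_factor; exists (GLval g); [exact: (GL_unitmx (g : GL)) | exact/eqP].
rewrite /= mul1n card_fiber // -[RHS]sum1_card.
rewrite (partition_big (fun g : GL => X *m GLval g)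
  (mem [set Y' : 'M_(d, n.+1) | lker X == lker Y'])) /= => [|g _]; last first.
  by rewrite inE; apply/lker_unit_factor; exists (GLval g) => //; exact: (GL_unitmx (g : GL)).
rewrite mulnC -sum_nat_const; apply: eq_bigr => Y'; rewrite inE => /card_fiber <-.
by rewrite -sum1_card; apply: eq_bigl => g; rewrite inE.
Qed.

Lemma prob_transport (X Y : 'M[K]_(d, n.+1)) :
  #|[set g : GL | X *m GLval g == Y]|%:R / #|{: GL}|%:R
    = (lker X == lker Y)%:R / (inj_poly R K (\rank X)).[(q ^ n.+1)%:R].
Proof.
have nzGL : #|{: GL}|%:R != 0 :> R.
  by rewrite pnatr_eq0 -lt0n; apply/card_gt0P; exists 1%g.
have nzX : (inj_poly R K (\rank X)).[(q ^ n.+1)%:R] != 0 :> R.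
  rewrite -(card_lker R n.+1 X) pnatr_eq0 -lt0n; apply/card_gt0P.
  by exists X; rewrite inE.
apply/eqP; rewrite eqr_div // -(card_lker R n.+1 X) -!natrM card_transport.
by [].
Qed.

(** The range of the right-hand sum, the set of canonical representatives, does
    not depend on the number [n] of columns; this is what makes a sum over
    matrices of varying width accessible to a formula uniform in [n].  A
    representative [W] of rank greater than [n] stands for an empty class, and
    its polynomial is then zero at [q ^ n]. *)
Lemma sum_lker (F : 'M[K]_(d, n) -> R) (f : 'M[K]_d -> R) :
    (forall W Z, lker W = lker Z -> F Z = f W) ->
  \sum_Z F Z = \sum_(W : 'M[K]_d | cokermx (lker W) == W)
                 f W * (inj_poly R K (\rank W)).[(q ^ n)%:R].
Proof.
move=> Ff; pose c (Z : 'M[K]_(d, n)) := cokermx (lker Z).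
rewrite (partition_big c (fun W => cokermx (lker W) == W)) => [|Z _] /=; last first.
  by rewrite lker_coker_lker.
apply: eq_bigr => W /eqP cW.
rewrite -card_lker -sum1_card natr_sum mulr_sumr; apply: eq_big => [Z|Z /eqP cZ].
  rewrite inE; apply/eqP/eqP => [<- | eqWZ]; first exact: lker_coker_lker.
  by rewrite /c -eqWZ.
by rewrite mulr1; apply: Ff; rewrite -cZ lker_coker_lker.
Qed.

End ProbTransport.

(** * Random linear systems *)

Section MeanSolutions.
Set Implicit Arguments.
Unset Strict Implicit.
Variables (R : numFieldType) (K : finFieldType) (r : nat).
Local Notation q := #|K|.

Definition solves d e D n (A C : 'I_r -> 'M[K]_(d, D)) (H : 'M[K]_(e, D))
    (g : 'I_r -> {'GL_n.+1[K]}) (Z : 'M[K]_(D, n.+1)) : bool :=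
  (H *m Z == 0) && [forall j, A j *m Z *m GLval (g j) == C j *m Z].

(** Exchanging the sums, [Z] contributes the probability that it solves the
    system; the matrices [g j] being independent, this is a product over [j] of
    probabilities which depend on [Z] only through its left kernel. *)
Lemma mean_solutions d e D n (A C : 'I_r -> 'M[K]_(d, D)) (H : 'M[K]_(e, D)) :
  (\sum_(g : {ffun 'I_r -> {'GL_n.+1[K]}}) #|[set Z | solves A C H g Z]|%:R)
    / #|{ffun 'I_r -> {'GL_n.+1[K]}}|%:R
  = \sum_(W : 'M[K]_D | cokermx (lker W) == W)
     (H *m W == 0)%:R
     * (\prod_j ((lker (A j *m W) == lker (C j *m W))%:R
                 / (inj_poly R K (\rank (A j *m W))).[(q ^ n.+1)%:R]))
     * (inj_poly R K (\rank W)).[(q ^ n.+1)%:R].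
Proof.
pose F (Z : 'M[K]_(D, n.+1)) : R := (H *m Z == 0)%:R *
  \prod_j (#|[set g : {'GL_n.+1[K]} | A j *m Z *m GLval g == C j *m Z]|%:R
           / #|{: {'GL_n.+1[K]}}|%:R).
rewrite -(@sum_lker _ _ _ _ F) => [|W Z eqWZ]; last first.
  rewrite /F (lker_eq0 H eqWZ); congr (_ * _); apply: eq_bigr => j _.
  rewrite prob_transport (lker_mull (A j) eqWZ) (lker_mull (C j) eqWZ).
  by rewrite (lker_rank (lker_mull (A j) eqWZ)).
have count_solutions (g : 'I_r -> {'GL_n.+1[K]}) : #|[set Z | solves A C H g Z]|%:R
    = \sum_Z (solves A C H g Z)%:R :> R.
  by rewrite -sum1dep_card big_mkcond natr_sum; apply: eq_bigr => Z _; case: ifP.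
under eq_bigr => g _ do rewrite count_solutions.
rewrite exchange_big mulr_suml /=.
apply: eq_bigr => Z _; rewrite /F prodf_div prodr_const card_ord card_ffun card_ord.
rewrite natrX mulrA; congr (_ / _).
have count_fiber j : #|[set h : {'GL_n.+1[K]} | A j *m Z *m GLval h == C j *m Z]|%:R
    = \sum_(h : {'GL_n.+1[K]}) (A j *m Z *m GLval h == C j *m Z)%:R :> R.
  by rewrite -sum1dep_card big_mkcond natr_sum; apply: eq_bigr => h _; case: ifP.
under [in RHS]eq_bigr => j _ do rewrite count_fiber.
rewrite bigA_distr_bigA mulr_sumr; apply: eq_bigr => g _.
rewrite /solves -mulnb natrM -natr_prod; congr (_ * _%:R).
case: forallP => [allj | /forallP nall].
  by rewrite big1 // => j _; rewrite allj.
by have /forallPn[j /negbTE nj] := nall; rewrite (bigD1 j) //= nj mul0n.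
Qed.

End MeanSolutions.

(** * From word equations to linear systems *)

Section Trajectories.
Set Implicit Arguments.
Unset Strict Implicit.
Variables (K : finFieldType) (r m : nat).

(** One side of a system to which the step from [X *m Z] to [Y *m Z] along the
    letter [a] is added; the other side is obtained by exchanging [X] and [Y].
    For an inverse letter the step is read backwards, from [Y *m Z] to
    [X *m Z], so that only [g a.1] itself occurs.  The generators other than
    [a.1] receive the trivial equation [0 = 0], which keeps the number of rows
    the same for all of them. *)
Definition add_rows d D (a : letter r) (X Y : 'M[K]_(m, D))
    (A : 'I_r -> 'M[K]_(d, D)) (j : 'I_r) : 'M[K]_(d + m, D) :=
  col_mx (A j) (if j == a.1 then if a.2 then Y else X else 0).

Lemma add_rows_system d D n (a : letter r) (X Y : 'M[K]_(m, D))
    (A C : 'I_r -> 'M[K]_(d, D)) (g : 'I_r -> {'GL_n.+1[K]}) (Z : 'M_(D, n.+1)) :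
  [forall j, add_rows a X Y A j *m Z *m GLval (g j) == add_rows a Y X C j *m Z]
  = [forall j, A j *m Z *m GLval (g j) == C j *m Z]
    && (X *m Z *m GLval (eval_letter g a) == Y *m Z).
Proof.
case: a => i b.
have new_row : (X *m Z *m GLval (eval_letter g (i, b)) == Y *m Z)
    = ((if b then Y else X) *m Z *m GLval (g i) == (if b then X else Y) *m Z).
  have gU : GLval (g i) \in unitmx := GL_unitmx (g i).
  case: b => //; rewrite (GL_VxE (g i) : GLval (eval_letter g (i, true)) = _) [RHS]eq_sym.
  by apply/eqP/eqP => [<- | ->]; rewrite ?mulmxK ?mulmxKV.
rewrite new_row.
have split_row j : add_rows (i, b) X Y A j *m Z *m GLval (g j)
      == add_rows (i, b) Y X C j *m Z
    = (A j *m Z *m GLval (g j) == C j *m Z)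
      && ((j == i) ==> ((if b then Y else X) *m Z *m GLval (g j)
                         == (if b then X else Y) *m Z)).
  rewrite /add_rows /= !mul_col_mx; case: (j == i); last first.
    by rewrite !mul0mx andbT; apply/eqP/eqP => [/eq_col_mx[] | ->].
  by rewrite /=; apply/eqP/andP => [/eq_col_mx[-> ->] | [/eqP-> /eqP->]].
apply/forallP/andP => [all_rows | [/forallP old_rows new] j].
  split; first by apply/forallP => j; have := all_rows j; rewrite split_row => /andP[].
  by have := all_rows i; rewrite split_row eqxx => /andP[].
rewrite split_row old_rows /=; apply/implyP => /eqP->; exact: new.
Qed.

(** Each letter is traded for [m] more rows of the unknown: the matrix reached
    from [E *m Z] after that letter joins the unknown, and is determined by
    [Z].  The induction needs arbitrary constraints [A], [C] and arbitrary end
    points [E], [F], as all of them change with the unknown. *)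
Lemma word_system (s : seq (letter r)) d D
    (A C : 'I_r -> 'M[K]_(d, D)) (E F : 'M[K]_(m, D)) :
  exists d' D' (A' C' : 'I_r -> 'M[K]_(d', D')) (H : 'M[K]_(m, D')),
    forall n (g : 'I_r -> {'GL_n.+1[K]}),
      #|[set Z : 'M[K]_(D, n.+1) | [forall j, A j *m Z *m GLval (g j) == C j *m Z]
         && (E *m Z *m GLval (\prod_(a <- s) eval_letter g a)%g == F *m Z)]|
      = #|[set Z | solves A' C' H g Z]|.
Proof.
elim: s d D A C E F => [|a s IHs] d D A C E F.
  exists d, D, A, C, (E - F) => n g; apply: eq_card => Z; rewrite !inE /solves.
  by rewrite andbC big_nil mulmx1 mulmxBl subr_eq0.
pose X : 'M[K]_(m, D + m) := row_mx E 0.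
pose Y : 'M[K]_(m, D + m) := row_mx 0 1%:M.
pose extend (L : 'I_r -> 'M[K]_(d, D)) j : 'M[K]_(d, D + m) := row_mx (L j) 0.
have [d' [D' [A' [C' [H card_system]]]]] := IHs _ _
  (add_rows a X Y (extend A)) (add_rows a Y X (extend C)) Y (row_mx F 0).
exists d', D', A', C', H => n g; rewrite -card_system.
pose next (Z : 'M[K]_(D, n.+1)) := E *m Z *m GLval (eval_letter g a).
have XE Z U : X *m col_mx Z U = E *m Z :> 'M_(m, n.+1).
  by rewrite mul_row_col mul0mx addr0.
have YE Z U : Y *m col_mx Z U = U :> 'M_(m, n.+1).
  by rewrite mul_row_col mul0mx add0r mul1mx.
have extendE L j Z U : extend L j *m col_mx Z U = L j *m Z :> 'M_(_, n.+1).
  by rewrite mul_row_col mul0mx addr0.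
rewrite -!sum1dep_card [RHS](reindex_onto (fun Z => col_mx Z (next Z)) usubmx) /=.
  apply: eq_bigl => Z; rewrite col_mxKu eqxx andbT add_rows_system XE YE eqxx andbT.
  rewrite mul_row_col mul0mx addr0 big_cons GL_MxE mulmxA; congr (_ && _).
  by apply: eq_forallb => j; rewrite !extendE.
move=> Z'; rewrite -[Z']vsubmxK add_rows_system XE YE col_mxKu.
by case/andP=> /andP[_ /eqP <-].
Qed.

End Trajectories.

(** * Functions that are eventually rational *)

Section EventuallyRational.
Set Implicit Arguments.
Unset Strict Implicit.
Variables (R : fieldType) (x : nat -> R).

Definition eventually_rational (f : nat -> R) :=
  exists (P Q : {poly R}) (N0 : nat),
    forall N, (N0 <= N)%N -> Q.[x N] != 0 /\ f N = P.[x N] / Q.[x N].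

Lemma eventually_rational_poly (P : {poly R}) : eventually_rational (fun N => P.[x N]).
Proof. by exists P, 1, 0 => N _; rewrite hornerC oner_neq0 divr1. Qed.

Lemma eventually_rational_inv (P : {poly R}) N0 :
  (forall N, (N0 <= N)%N -> P.[x N] != 0) ->
  eventually_rational (fun N => P.[x N]^-1).
Proof. by move=> nzP; exists 1, P, N0 => N /nzP; rewrite hornerC div1r. Qed.

Lemma eventually_rationalD f g : eventually_rational f -> eventually_rational g ->
  eventually_rational (fun N => f N + g N).
Proof.
move=> [P1 [Q1 [N1 h1]]] [P2 [Q2 [N2 h2]]].
exists (P1 * Q2 + P2 * Q1), (Q1 * Q2), (maxn N1 N2) => N; rewrite geq_max.
case/andP=> /h1[nz1 ->] /h2[nz2 ->].
by rewrite !hornerE mulf_neq0 // addf_div.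
Qed.

Lemma eventually_rationalM f g : eventually_rational f -> eventually_rational g ->
  eventually_rational (fun N => f N * g N).
Proof.
move=> [P1 [Q1 [N1 h1]]] [P2 [Q2 [N2 h2]]].
exists (P1 * P2), (Q1 * Q2), (maxn N1 N2) => N; rewrite geq_max.
case/andP=> /h1[nz1 ->] /h2[nz2 ->].
by rewrite !hornerM mulf_neq0 // mulf_div.
Qed.

Lemma eventually_rational_sum I (s : seq I) (P : pred I) (f : I -> nat -> R) :
  (forall i, eventually_rational (f i)) ->
  eventually_rational (fun N => \sum_(i <- s | P i) f i N).
Proof.
move=> rat_f; elim: s => [|i s [Q1 [Q2 [N0 IHs]]]].
  by exists 0, 1, 0 => N _; rewrite big_nil horner0 hornerC oner_neq0 mul0r.
have [|Q3 [Q4 [N1 hi]]] :=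
    @eventually_rationalD (f i) (fun N => \sum_(i <- s | P i) f i N) (rat_f i).
  by exists Q1, Q2, N0.
case Pi: (P i); [exists Q3, Q4, N1 => N /hi | exists Q1, Q2, N0 => N /IHs];
  by rewrite big_cons Pi.
Qed.

Lemma eventually_rational_prod I (s : seq I) (f : I -> nat -> R) :
  (forall i, eventually_rational (f i)) ->
  eventually_rational (fun N => \prod_(i <- s) f i N).
Proof.
move=> rat_f; elim: s => [|i s [Q1 [Q2 [N0 IHs]]]].
  by exists 1, 1, 0 => N _; rewrite big_nil !hornerC oner_neq0 divr1.
have [|Q3 [Q4 [N1 hi]]] :=
    @eventually_rationalM (f i) (fun N => \prod_(i <- s) f i N) (rat_f i).
  by exists Q1, Q2, N0.
by exists Q3, Q4, N1 => N /hi; rewrite big_cons.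
Qed.

End EventuallyRational.

Lemma inj_poly_neq0 (R : numFieldType) (K : finFieldType) k N :
  (k <= N)%N -> (inj_poly R K k).[(#|K| ^ N)%:R] != 0.
Proof.
move=> le_kN; rewrite /inj_poly horner_prod; apply/prodf_neq0 => i _.
rewrite !hornerE subr_eq0 eqr_nat eqn_exp2l ?card_finNzRing_gt1 //.
by rewrite gtn_eqF // (leq_trans (ltn_ord i)).
Qed.

(** * Rationality of the expectation *)

Theorem theorem1p11 (R : realType) (K : finFieldType) (r : nat) (hr : (0 < r)%N)
    (w : freeGroup r) (m : nat) (hm : (0 < m)%N) (B : {'GL_m[K]}) :
  exists (P Q : {poly R}) (N0 : nat),
    forall N : nat, (0 < N)%N -> (N0 <= N)%N ->
      Q.[(#|K| ^ N)%:R] != 0 /\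
      word_expectation w (fun g : {'GL_N[K]} => (fixcount B g)%:R)
      = P.[(#|K| ^ N)%:R] / Q.[(#|K| ^ N)%:R].
Proof.
(* The initial system has a constraint matrix with no row at all, and its
   unknown is the matrix M itself. *)
have [d [D [A [C [H card_system]]]]] :=
  @word_system K r m.-1.+1 (fg_word w) 0 _ (fun=> 0) (fun=> 0) 1%:M (GLval B).
pose x N : R := (#|K| ^ N)%:R.
pose mean N : R := \sum_(W : 'M[K]_D | cokermx (lker W) == W)
     (H *m W == 0)%:R
     * (\prod_j ((lker (A j *m W) == lker (C j *m W))%:R
                 / (inj_poly R K (\rank (A j *m W))).[x N]))
     * (inj_poly R K (\rank W)).[x N].
have [P [Q [N0 meanE]]] : eventually_rational x mean.
  apply: eventually_rational_sum => W.
  have rat_const c : eventually_rational x (fun=> c).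
    have := eventually_rational_poly x c%:P => - [P [Q [N0 h]]].
    by exists P, Q, N0 => N /h; rewrite hornerC.
  apply: eventually_rationalM; last exact: eventually_rational_poly.
  apply: eventually_rationalM; first exact: rat_const.
  apply: eventually_rational_prod => j.
  apply: eventually_rationalM; first exact: rat_const.
  apply: eventually_rational_inv (\rank (A j *m W)) _ => N.
  exact: inj_poly_neq0.
exists P, Q, N0 => -[//|n] _ /meanE[nzQ <-]; split=> //.
rewrite /mean -mean_solutions /word_expectation; congr (_ / _).
apply: eq_bigr => g _; congr (_%:R); rewrite -card_system /fixcount.
apply: eq_card => M; rewrite !inE mul1mx.
by case: forallP => // -[] j; rewrite !mul0mx.
Qed.
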